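(* Let $0<a<b$ and $0<s<1$. Then $$\left|L_s^s(a,b)-A^s(a,b)\right|\le \frac{(b-a)^2 s(1-s)}{8(s+1)(s+2)(s+3)}\left[a^{s-2}+(s^2+3s+2)A^{s-2}(a,b)+b^{s-2}\right]$$ and $$\left|L_s^s(a,b)-A\left(\left(\tfrac{3a+b}{4}\right)^s,\left(\tfrac{a+3b}{4}\right)^s\right)\right|\le \frac{(b-a)^2 s(1-s)}{8(s+1)(s+2)(s+3)}\left[2\left(a^{s-2}+b^{s-2}\right)+(3s^2+5s+6)\left(\left(\tfrac{3a+b}{4}\right)^{s-2}+\left(\tfrac{a+3b}{4}\right)^{s-2}\right)\right].$$
   Context: For nonnegative real numbers $\alpha,\beta$, $A(\alpha,\beta)=\frac{\alpha+\beta}{2}$ is the arithmetic mean, and $A^r(\alpha,\beta)=(A(\alpha,\beta))^r$. For $0<\alpha<\beta$ and a real exponent $n\ne -1,0$, $L_n(\alpha,\beta)=\left[\frac{\beta^{n+1}-\alpha^{n+1}}{(\beta-\alpha)(n+1)}\right]^{1/n}$ is the generalized logarithmic mean, and $L_n^n(\alpha,\beta)=(L_n(\alpha,\beta))^n=\frac{\beta^{n+1}-\alpha^{n+1}}{(\beta-\alpha)(n+1)}$. *)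

(* Defs.v *)
From Stdlib Require Import Reals.
Open Scope R_scope.

(* Real powers are [Rpower x y = exp (y * ln x)], which is the usual power only
   for a positive base; all bases below are positive when 0 < alpha < beta. *)

Definition arith_mean (alpha beta : R) : R := (alpha + beta) / 2.

(* Generalized logarithmic mean L_n(alpha, beta) with real exponent [n];
   meaningful for 0 < alpha < beta and n different from -1 and 0. *)
Definition gen_log_mean (n alpha beta : R) : R :=
  Rpower ((Rpower beta (n + 1) - Rpower alpha (n + 1))
          / ((beta - alpha) * (n + 1)))
         (1 / n).

(* Main.v *)
Require Import Defs.
From Stdlib Require Import Reals.
From Stdlib Require Import Lra.
From Coquelicot Require Import Coquelicot.
Open Scope R_scope.

(** Write [f x = x^s] and [g x = - f'' x = s (1 - s) x^(s-2)], a nonnegative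
    convex function on the positive half-line.  The number [L_s^s(a,b)] is the
    mean value of [f] over [[a, b]], so both estimates bound the error of a
    midpoint rule.

    With [m] the midpoint and [h = (b-a)/2], that error is governed by
    [E t = 2 t f(m) - (F (m+t) - F (m-t))], where [F' = f]; it vanishes
    at [0] with its first two derivatives, and
    [E''' t = g (m+t) + g (m-t)].  This is nonnegative, and convexity of [g]
    bounds it from above on [[0, h]] by the affine function with the same values
    at [0] and [h].  Integrating three times gives
    [0 <= f m - mean <= (b-a)^2 / 192 * (g a + 6 g m + g b)]
    ([midpoint_defect]).

    The first announced bound has this shape, with the coefficients [1], [6], [1]
    over [192] that its own coefficients take at [s = 1].  They only grow when
    [s] decreases, because [(s+1)(s+2)(s+3) <= 24] and [s + 3 <= 4].

    For the second, the estimate is applied on both halves of [[a, b]], and the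
    value of [g] at the midpoint, which then appears, is bounded by the average
    of its values at the two quarter points.  This gives the coefficients [1]
    and [7] over [1536], well below the announced ones, which are at least [2]
    and [6] over [192]. *)

(** * A midpoint rule for functions with convex second derivative *)

Lemma nonneg_of_derive_nonneg (u u' : R -> R) (h : R) :
  u 0 = 0 ->
  (forall t, 0 <= t <= h -> is_derive u t (u' t)) ->
  (forall t, 0 <= t <= h -> 0 <= u' t) ->
  forall t, 0 <= t <= h -> 0 <= u t.
Proof.
intros u0 du u'_ge0 t ht.
destruct (Req_dec t 0) as [->|tn0]; [lra|].
destruct (MVT_cor2 u u' 0 t) as [c [Ec hc]]; [lra| |].
- intros c hc. apply is_derive_Reals, du. lra.
- assert (0 <= u' c) by (apply u'_ge0; lra). nra.
Qed.

(** Nonnegativity survives each of the three integrations from [0]. *)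
Lemma nonneg_of_third_derive_nonneg (u u1 u2 u3 : R -> R) (h : R) :
  0 <= h ->
  u 0 = 0 -> u1 0 = 0 -> u2 0 = 0 ->
  (forall t, 0 <= t <= h -> is_derive u t (u1 t)) ->
  (forall t, 0 <= t <= h -> is_derive u1 t (u2 t)) ->
  (forall t, 0 <= t <= h -> is_derive u2 t (u3 t)) ->
  (forall t, 0 <= t <= h -> 0 <= u3 t) ->
  0 <= u h.
Proof.
intros hh u0 u10 u20 du du1 du2 u3_ge0.
apply (nonneg_of_derive_nonneg u u1 h); [easy..| |lra].
apply (nonneg_of_derive_nonneg u1 u2 h); [easy..|].
now apply (nonneg_of_derive_nonneg u2 u3 h).
Qed.

Definition convex_between (g : R -> R) (a b : R) : Prop :=
  forall x y t, a <= x <= b -> a <= y <= b -> 0 <= t <= 1 ->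
  g ((1 - t) * x + t * y) <= (1 - t) * g x + t * g y.

(** As a function of [t], the left side is convex with value [2 g m] at [0], so
    it lies below its chord over [[0, h]]. *)
Lemma convex_even_part_le_chord (g : R -> R) (m h t : R) :
  0 < h -> convex_between g (m - h) (m + h) -> 0 <= t <= h ->
  g (m + t) + g (m - t)
  <= 2 * g m + (g (m + h) + g (m - h) - 2 * g m) / h * t.
Proof.
intros hh cvx ht.
assert (hq : 0 <= t / h <= 1).
{ split; [apply Rdiv_le_0_compat; lra|].
  apply Rle_div_l; lra. }
assert (Hr := cvx m (m + h) (t / h) ltac:(lra) ltac:(lra) hq).
assert (Hl := cvx m (m - h) (t / h) ltac:(lra) ltac:(lra) hq).
replace ((1 - t / h) * m + t / h * (m + h)) with (m + t) in Hr by (field; lra).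
replace ((1 - t / h) * m + t / h * (m - h)) with (m - t) in Hl by (field; lra).
replace (_ / h * t) with (t / h * (g (m + h) + g (m - h) - 2 * g m))
  by (field; lra).
lra.
Qed.

(** The weights [1, 6, 1] come from integrating the chord of
    [g (m+t) + g (m-t)] three times; they are optimal, since the function is its
    own chord when [g] is affine on each half of the interval. *)
Lemma midpoint_defect (F f f1 g : R -> R) (a b : R) :
  a < b ->
  (forall x, a <= x <= b -> is_derive F x (f x)) ->
  (forall x, a <= x <= b -> is_derive f x (f1 x)) ->
  (forall x, a <= x <= b -> is_derive f1 x (- g x)) ->
  (forall x, a <= x <= b -> 0 <= g x) ->
  convex_between g a b ->
  0 <= f ((a + b) / 2) - (F b - F a) / (b - a)
    <= (b - a) ^ 2 / 192 * (g a + 6 * g ((a + b) / 2) + g b).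
Proof.
intros hab dF df df1 g_ge0 cvx.
set (m := (a + b) / 2); set (h := (b - a) / 2).
assert (hh : 0 < h) by (unfold h; lra).
assert (Ea : a = m - h) by (unfold m, h; field).
assert (Eb : b = m + h) by (unfold m, h; field).
clearbody m h; subst a b.
set (k := (g (m + h) + g (m - h) - 2 * g m) / h).
set (E := fun t => 2 * t * f m - (F (m + t) - F (m - t))).
set (E1 := fun t => 2 * f m - (f (m + t) + f (m - t))).
set (E2 := fun t => - (f1 (m + t) - f1 (m - t))).
set (E3 := fun t => g (m + t) + g (m - t)).
assert (refl_derive : forall (p q : R -> R) (t : R), 0 <= t <= h ->
  (forall x, m - h <= x <= m + h -> is_derive p x (q x)) ->
  is_derive (fun t => p (m + t)) t (q (m + t)) /\
  is_derive (fun t => p (m - t)) t (- q (m - t))).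
{ intros p q t ht dp.
  assert (dr := dp (m + t) ltac:(lra)).
  assert (dl := dp (m - t) ltac:(lra)).
  split.
  - replace (q (m + t)) with (scal 1 (q (m + t)))
      by (unfold scal; simpl; apply Rmult_1_l).
    apply (is_derive_comp p); [easy|auto_derive; [easy|ring]].
  - replace (- q (m - t)) with (scal (- 1) (q (m - t)))
      by (unfold scal; simpl; unfold mult; simpl; ring).
    apply (is_derive_comp p); [easy|auto_derive; [easy|ring]]. }
assert (dE : forall t, 0 <= t <= h -> is_derive E t (E1 t)).
{ intros t ht. destruct (refl_derive F f t ht dF) as [dr dl].
  unfold E, E1.
  replace (2 * f m - (f (m + t) + f (m - t)))
    with (minus (2 * f m) (minus (f (m + t)) (- f (m - t))))
    by (unfold minus, plus, opp; simpl; ring).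
  apply @is_derive_minus; [auto_derive; [easy|ring]|].
  now apply @is_derive_minus. }
assert (dE1 : forall t, 0 <= t <= h -> is_derive E1 t (E2 t)).
{ intros t ht. destruct (refl_derive f f1 t ht df) as [dr dl].
  unfold E1, E2.
  replace (- (f1 (m + t) - f1 (m - t)))
    with (minus 0 (plus (f1 (m + t)) (- f1 (m - t))))
    by (unfold minus, plus, opp; simpl; ring).
  apply @is_derive_minus; [auto_derive; [easy|ring]|].
  now apply @is_derive_plus. }
assert (dE2 : forall t, 0 <= t <= h -> is_derive E2 t (E3 t)).
{ intros t ht.
  destruct (refl_derive f1 (fun x => - g x) t ht df1) as [dr dl].
  unfold E2, E3.
  replace (g (m + t) + g (m - t))
    with (opp (minus (- g (m + t)) (- - g (m - t))))
    by (unfold minus, plus, opp; simpl; ring).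
  apply @is_derive_opp.
  now apply @is_derive_minus. }
assert (E0 : E 0 = 0) by (unfold E; rewrite Rplus_0_r, Rminus_0_r; ring).
assert (E10 : E1 0 = 0) by (unfold E1; rewrite Rplus_0_r, Rminus_0_r; ring).
assert (E20 : E2 0 = 0) by (unfold E2; rewrite Rplus_0_r, Rminus_0_r; ring).
assert (E_ge0 : 0 <= E h).
{ apply (nonneg_of_third_derive_nonneg E E1 E2 E3); try easy; [lra|].
  intros t ht. unfold E3.
  assert (0 <= g (m + t)) by (apply g_ge0; lra).
  assert (0 <= g (m - t)) by (apply g_ge0; lra).
  lra. }
(* The polynomial is the chord [2 g m + k t], integrated three times. *)
assert (E_le : 0 <= 2 * g m * h ^ 3 / 6 + k * h ^ 4 / 24 - E h).
{ apply (nonneg_of_third_derive_nonneg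
    (fun t => 2 * g m * t ^ 3 / 6 + k * t ^ 4 / 24 - E t)
    (fun t => 2 * g m * t ^ 2 / 2 + k * t ^ 3 / 6 - E1 t)
    (fun t => 2 * g m * t + k * t ^ 2 / 2 - E2 t)
    (fun t => 2 * g m + k * t - E3 t)).
  - lra.
  - rewrite E0. field.
  - rewrite E10. field.
  - rewrite E20. field.
  - intros t ht. apply @is_derive_minus; [auto_derive; [easy|field]|auto].
  - intros t ht. apply @is_derive_minus; [auto_derive; [easy|field]|auto].
  - intros t ht. apply @is_derive_minus; [auto_derive; [easy|field]|auto].
  - intros t ht.
    assert (H := convex_even_part_le_chord g m h t hh cvx ht).
    fold k in H. unfold E3. lra. }
replace (m + h - (m - h)) with (2 * h) by ring.
replace (f m - _) with (E h / (2 * h)) by (unfold E; field; lra).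
replace (_ / 192 * _)
  with ((2 * g m * h ^ 3 / 6 + k * h ^ 4 / 24) / (2 * h))
  by (unfold k; field; lra).
split.
- apply Rdiv_le_0_compat; lra.
- apply Rmult_le_compat_r; [|lra].
  left; apply Rinv_0_lt_compat; lra.
Qed.

(** * Real powers *)

Lemma is_derive_Rpower (p x : R) :
  0 < x -> is_derive (fun y => Rpower y p) x (p * Rpower x (p - 1)).
Proof. intros hx. apply is_derive_Reals. now apply derivable_pt_lim_power. Qed.

(** For [p <= 0] the graph of [x^p] lies above its tangents: divide by [z^p],
    and use [exp u >= 1 + u] together with [ln v <= v - 1]. *)
Lemma Rpower_ge_tangent (p x z : R) :
  p <= 0 -> 0 < x -> 0 < z ->
  Rpower z p * (1 + p * (x / z - 1)) <= Rpower x p.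
Proof.
intros hp hx hz.
assert (hv : 0 < x / z) by (apply Rdiv_lt_0_compat; lra).
replace (Rpower x p) with (Rpower z p * Rpower (x / z) p)
  by (rewrite Rpower_mult_distr by easy; f_equal; field; lra).
apply Rmult_le_compat_l; [left; apply exp_pos|].
assert (hln : ln (x / z) <= x / z - 1).
{ assert (H := exp_ineq1_le (ln (x / z))). rewrite exp_ln in H by easy. lra. }
assert (H := exp_ineq1_le (p * ln (x / z))). unfold Rpower. nra.
Qed.

Lemma convex_Rpower_neg (p a b : R) :
  p <= 0 -> 0 < a -> convex_between (fun x => Rpower x p) a b.
Proof.
intros hp ha x y t hx hy ht; simpl.
set (z := (1 - t) * x + t * y).
assert (hz : 0 < z) by (unfold z; nra).
assert (Hx := Rpower_ge_tangent p x z hp ltac:(lra) hz).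
assert (Hy := Rpower_ge_tangent p y z hp ltac:(lra) hz).
(* The slopes cancel in the weighted sum because [z] is the barycentre. *)
replace (Rpower z p)
  with ((1 - t) * (Rpower z p * (1 + p * (x / z - 1)))
        + t * (Rpower z p * (1 + p * (y / z - 1)))).
- apply Rplus_le_compat; apply Rmult_le_compat_l; lra.
- replace (_ + _)
    with (Rpower z p * (1 + p * (((1 - t) * x + t * y) / z - 1)))
    by (field; lra).
  fold z. field; lra.
Qed.

Lemma Rpower_midpoint_defect (s a b : R) :
  0 < s < 1 -> 0 < a < b ->
  0 <= Rpower ((a + b) / 2) s
       - (Rpower b (s + 1) / (s + 1) - Rpower a (s + 1) / (s + 1)) / (b - a)
    <= (b - a) ^ 2 * s * (1 - s) / 192
       * (Rpower a (s - 2) + 6 * Rpower ((a + b) / 2) (s - 2)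
          + Rpower b (s - 2)).
Proof.
intros hs hab.
assert (hs2 : 0 <= s * (1 - s)) by nra.
destruct (midpoint_defect
  (fun x => Rpower x (s + 1) / (s + 1)) (fun x => Rpower x s)
  (fun x => s * Rpower x (s - 1))
  (fun x => s * (1 - s) * Rpower x (s - 2)) a b) as [Hl Hu].
- lra.
- intros x hx.
  replace (Rpower x s) with (/ (s + 1) * ((s + 1) * Rpower x (s + 1 - 1)))
    by (replace (s + 1 - 1) with s by ring; field; lra).
  apply (is_derive_ext (fun y => / (s + 1) * Rpower y (s + 1))).
  { intros y. apply Rmult_comm. }
  apply is_derive_scal, is_derive_Rpower. lra.
- intros x hx. apply is_derive_Rpower. lra.
- intros x hx.
  replace (- (s * (1 - s) * Rpower x (s - 2)))
    with (s * ((s - 1) * Rpower x (s - 1 - 1)))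
    by (replace (s - 1 - 1) with (s - 2) by ring; ring).
  apply is_derive_scal, is_derive_Rpower. lra.
- intros x hx. apply Rmult_le_pos; [easy|left; apply exp_pos].
- intros x y t hx hy ht.
  assert (H := convex_Rpower_neg (s - 2) a b ltac:(lra) ltac:(lra)
    x y t hx hy ht).
  simpl in H. nra.
- simpl in Hl, Hu. split; [easy|].
  eapply Rle_trans; [exact Hu|]. apply Req_le. field.
Qed.

Lemma gen_log_mean_Rpower (s a b : R) :
  0 < s -> 0 < a < b ->
  Rpower (gen_log_mean s a b) s
  = (Rpower b (s + 1) / (s + 1) - Rpower a (s + 1) / (s + 1)) / (b - a).
Proof.
intros hs hab.
unfold gen_log_mean. rewrite Rpower_mult.
replace (1 / s * s) with 1 by (field; lra).
rewrite Rpower_1.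
- field; lra.
- assert (Rpower a (s + 1) < Rpower b (s + 1)) by (apply Rlt_Rpower_l; lra).
  apply Rdiv_lt_0_compat; nra.
Qed.

(** * The two estimates *)

Theorem proposition1 (a b s : R) (ha : 0 < a) (hab : a < b)
  (hs0 : 0 < s) (hs1 : s < 1) :
  Rabs (Rpower (gen_log_mean s a b) s - Rpower (arith_mean a b) s)
  <= ((b - a) ^ 2 * s * (1 - s)) / (8 * (s + 1) * (s + 2) * (s + 3))
     * (Rpower a (s - 2)
        + (s ^ 2 + 3 * s + 2) * Rpower (arith_mean a b) (s - 2)
        + Rpower b (s - 2))
  /\
  Rabs (Rpower (gen_log_mean s a b) s
        - arith_mean (Rpower ((3 * a + b) / 4) s) (Rpower ((a + 3 * b) / 4) s))
  <= ((b - a) ^ 2 * s * (1 - s)) / (8 * (s + 1) * (s + 2) * (s + 3))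
     * (2 * (Rpower a (s - 2) + Rpower b (s - 2))
        + (3 * s ^ 2 + 5 * s + 6)
          * (Rpower ((3 * a + b) / 4) (s - 2)
             + Rpower ((a + 3 * b) / 4) (s - 2))).
Proof.
rewrite gen_log_mean_Rpower by lra.
unfold arith_mean.
set (K := (b - a) ^ 2 * s * (1 - s)).
assert (hK : 0 <= K).
{ unfold K. apply Rmult_le_pos; [|lra]. apply Rmult_le_pos; [nra|lra]. }
set (c := K / (8 * (s + 1) * (s + 2) * (s + 3))).
(* The product in the denominator of [c] is largest, namely 24, at [s = 1]. *)
assert (hcK : K / 192 <= c).
{ unfold c, Rdiv. apply Rmult_le_compat_l; [easy|].
  apply Rinv_le_contravar; [|nra].
  repeat apply Rmult_lt_0_compat; lra. }
assert (hcK' : K / 32 <= c * (s ^ 2 + 3 * s + 2)).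
{ replace (c * _) with (K / (8 * (s + 3))) by (unfold c; field; lra).
  unfold Rdiv. apply Rmult_le_compat_l; [easy|].
  apply Rinv_le_contravar; lra. }
assert (Rpow_pos : forall x p, 0 < Rpower x p) by (intros; apply exp_pos).
set (A := Rpower a (s - 2)); assert (hA : 0 < A) by apply Rpow_pos.
set (B := Rpower b (s - 2)); assert (hB : 0 < B) by apply Rpow_pos.
set (p := (3 * a + b) / 4); set (q := (a + 3 * b) / 4).
set (m := (a + b) / 2).
set (M := Rpower m (s - 2)); assert (hM : 0 < M) by apply Rpow_pos.
set (P := Rpower p (s - 2)); assert (hP : 0 < P) by apply Rpow_pos.
set (Q := Rpower q (s - 2)); assert (hQ : 0 < Q) by apply Rpow_pos.
split.
- destruct (Rpower_midpoint_defect s a b ltac:(lra) ltac:(lra)) as [Hl Hu].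
  fold m A B M K in Hl, Hu.
  rewrite Rabs_minus_sym, Rabs_pos_eq by easy.
  nra.
- destruct (Rpower_midpoint_defect s a m) as [Hl1 Hu1]; [lra|unfold m; lra|].
  destruct (Rpower_midpoint_defect s m b) as [Hl2 Hu2]; [lra|unfold m; lra|].
  replace ((a + m) / 2) with p in Hl1, Hu1 by (unfold p, m; field).
  replace ((m + b) / 2) with q in Hl2, Hu2 by (unfold q, m; field).
  fold A M P in Hu1. fold B M Q in Hu2.
  replace ((m - a) ^ 2 * s * (1 - s) / 192) with (K / 768) in Hu1
    by (unfold K, m; field).
  replace ((b - m) ^ 2 * s * (1 - s) / 192) with (K / 768) in Hu2
    by (unfold K, m; field).
  set (F := fun x => Rpower x (s + 1) / (s + 1)).
  fold (F a) (F b) (F m) in Hl1, Hu1, Hl2, Hu2 |- *.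
  (* The mean over the whole interval is the average of those over its halves. *)
  assert (Emean : (F b - F a) / (b - a)
    = ((F m - F a) / (m - a) + (F b - F m) / (b - m)) / 2)
    by (unfold m at 2 4; field; lra).
  assert (hMPQ : M <= (P + Q) / 2).
  { assert (H := convex_Rpower_neg (s - 2) a b ltac:(lra) ha p q (1 / 2)
      ltac:(unfold p; lra) ltac:(unfold q; lra) ltac:(lra)).
    simpl in H.
    replace ((1 - 1 / 2) * p + 1 / 2 * q) with m in H by (unfold p, q, m; field).
    fold M P Q in H. lra. }
  rewrite Rabs_minus_sym, Rabs_pos_eq by lra.
  apply Rle_trans with (K / 768 * (A + 6 * P + M + (M + 6 * Q + B)) / 2); [lra|].
  apply Rle_trans with (K / 192 * (2 * (A + B) + 6 * (P + Q))); [nra|].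
  apply Rmult_le_compat; nra.
Qed.
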